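(* The fully discrete upwind Lagrange multiplier scheme (S1)--(S9) described in the context ensures that the total mass is conserved during the evolution, i.e., for every solution of the scheme and every $n\in\{0,\dots,N-1\}$, $$m^{n+1}:=\sum_{i=1}^{N_x}\sum_{j=1}^{N_y}\phi_{i,j}^{n+1}=\sum_{i=1}^{N_x}\sum_{j=1}^{N_y}\phi_{i,j}^{n}=\cdots=\sum_{i=1}^{N_x}\sum_{j=1}^{N_y}\phi_{i,j}^{0}.$$
   Context: Parameters: real numbers $0<\varepsilon\ll1$ (interface width), $\kappa>0$ (contact line mobility), time step $\Delta t>0$, spatial steps $\Delta x>0$, $\Delta y>0$, prescribed contact angle $\theta_s\in[0,\pi]$, and positive integers $N_x,N_y,N$. A rectangular domain is divided into cells indexed by $i=1,\dots,N_x$, $j=1,\dots,N_y$; the row $j=1$ is adjacent to the substrate $\Gamma_w$, and the other three sides form the non-substrate boundary $\Gamma_n$. $\phi_{i,j}^n$ denotes the (approximate) cell average of the phase variable at time $n\Delta t$. Potential: $F$ is one of the following. (Logarithmic Flory--Huggins) $F(\chi)=F_{log}(\chi)-F_{log}(\beta)$ with $F_{log}(\chi)=\frac{\theta}{2}[(1+\chi)\ln(1+\chi)+(1-\chi)\ln(1-\chi)]+\frac12(1-\chi^2)$, $0<\theta<1$, where $\beta\in(0,1)$ is the positive root of $F_{log}'(\chi)=\frac{\theta}{2}\ln\frac{1+\chi}{1-\chi}-\chi=0$; (Polynomial) $F(\chi)=\frac14(1-\chi^2)^2$, with $\beta=1$. Put $c_F=\int_{-\beta}^{\beta}\sqrt{2F(\chi)}\,d\chi$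 and $g(\chi)=\frac{\varepsilon c_F\cos\theta_s}{4\beta^3}(\chi^3-3\beta^2\chi)$. Notation: $\chi^+=\max\{\chi,0\}$, $\chi^-=\min\{\chi,0\}$, and the two-state upwind mobility is $M(\chi_1,\chi_2)=(1+\chi_1)^+(1-\chi_2)^+$. Scheme: a solution consists of $\phi_{i,j}^n$ ($0\le n\le N$) and, for each $n=0,\dots,N-1$, values $\mu_{i,j}^{n+1}$, fluxes $J^{n+1}$, velocities $V^{n+1}$, scalars $\xi^{n+1},\eta^{n+1}$ (independent of $i,j$) and ghost values such that: (S1) $\phi_{i,j}^{n+1}-\phi_{i,j}^{n}=-\left[\frac{\Delta t}{\Delta x}(J_{i+\frac12,j}^{n+1}-J_{i-\frac12,j}^{n+1})+\frac{\Delta t}{\Delta y}(J_{i,j+\frac12}^{n+1}-J_{i,j-\frac12}^{n+1})\right]$ for all cells. (S2) $J_{i+\frac12,j}^{n+1}=(V_{i+\frac12,j}^{n+1})^+M(\phi_{i,j}^{n+1},\phi_{i+1,j}^{n+1})+(V_{i+\frac12,j}^{n+1})^-M(\phi_{i+1,j}^{n+1},\phi_{i,j}^{n+1})$, with $V_{i+\frac12,j}^{n+1}=-\frac{1}{\Delta x}(\mu_{i+1,j}^{n+1}-\mu_{i,j}^{n+1})$ (faces between two cells; boundary faces are covered by (S4)). (S3) $J_{i,j+\frac12}^{n+1}=(V_{i,j+\frac12}^{n+1})^+M(\phi_{i,j}^{n+1},\phi_{i,j+1}^{n+1})+(V_{i,j+\frac12}^{n+1})^-M(\phi_{i,j+1}^{n+1},\phi_{i,j}^{n+1})$,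 with $V_{i,j+\frac12}^{n+1}=-\frac{1}{\Delta y}(\mu_{i,j+1}^{n+1}-\mu_{i,j}^{n+1})$ (faces between two cells; boundary faces are covered by (S4)). (S4) No flux: $J_{\frac12,j}^{n+1}=J_{N_x+\frac12,j}^{n+1}=0$ and $J_{i,\frac12}^{n+1}=J_{i,N_y+\frac12}^{n+1}=0$. (S5) $\mu_{i,j}^{n+1}=-\varepsilon^2(\Delta\phi)_{i,j}^{n+1}+\xi^{n+1}F'(\phi_{i,j}^{n+1})$. (S6) $(\Delta\phi)_{i,j}^{n+1}=\frac{\phi_{i+1,j}^{n+1}-2\phi_{i,j}^{n+1}+\phi_{i-1,j}^{n+1}}{\Delta x^2}+\frac{\phi_{i,j+1}^{n+1}-2\phi_{i,j}^{n+1}+\phi_{i,j-1}^{n+1}}{\Delta y^2}$. (S7) Ghost values (encoding the homogeneous Neumann condition on $\Gamma_n$ and the dynamic contact line condition $\phi_{i,1}^{n+1}-\phi_{i,1}^{n}=-\kappa\Delta t\,(-\varepsilon^2\frac{\phi_{i,1}^{n+1}-\phi_{i,0}^{n+1}}{\Delta y}+\eta^{n+1}g'(\phi_{i,1}^{n+1}))$ on $\Gamma_w$): $\phi_{0,j}^{n+1}=\phi_{1,j}^{n+1}$, $\phi_{N_x+1,j}^{n+1}=\phi_{N_x,j}^{n+1}$, $\phi_{i,N_y+1}^{n+1}=\phi_{i,N_y}^{n+1}$, and $\phi_{i,0}^{n+1}=\left(1-\frac{\Delta y}{\varepsilon^2\kappa\Delta t}\right)\phi_{i,1}^{n+1}+\frac{\Delta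 y}{\varepsilon^2\kappa\Delta t}\phi_{i,1}^{n}-\frac{\Delta y}{\varepsilon^2}\eta^{n+1}g'(\phi_{i,1}^{n+1})$. (S8) $\sum_{i=1}^{N_x}\sum_{j=1}^{N_y}(F(\phi_{i,j}^{n+1})-F(\phi_{i,j}^{n}))=\xi^{n+1}\sum_{i=1}^{N_x}\sum_{j=1}^{N_y}F'(\phi_{i,j}^{n+1})(\phi_{i,j}^{n+1}-\phi_{i,j}^{n})$. (S9) $\sum_{i=1}^{N_x}(g(\phi_{i,1}^{n+1})-g(\phi_{i,1}^{n}))=\eta^{n+1}\sum_{i=1}^{N_x}g'(\phi_{i,1}^{n+1})(\phi_{i,1}^{n+1}-\phi_{i,1}^{n})$. *)

(* Defs.v *)
From HB Require Import structures.
From mathcomp Require Import all_boot all_order all_algebra.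
From mathcomp Require Import all_classical all_reals all_analysis.
Set Implicit Arguments.
Unset Strict Implicit.
Unset Printing Implicit Defensive.
Import Order.TTheory GRing.Theory Num.Theory.
Import numFieldNormedType.Exports.
Local Open Scope classical_set_scope.
Local Open Scope ring_scope.

(** ** The bulk potential and the wall energy *)

Section Potential.
Variable R : realType.

Definition F_log (theta chi : R) : R :=
  theta / 2 * ((1 + chi) * ln (1 + chi) + (1 - chi) * ln (1 - chi))
  + (1 - chi ^+ 2) / 2.

Definition F_poly (chi : R) : R := (1 - chi ^+ 2) ^+ 2 / 4.

(* The parameter [beta] of [FloryHuggins] is pinned down by [potential_ok]. *)
Inductive potential : Type :=
  | FloryHuggins (theta beta : R)
  | Polynomial.

Definition potential_ok (p : potential) : Prop :=
  match p with
  | FloryHuggins theta beta =>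
      [/\ 0 < theta < 1, 0 < beta < 1 & derive1 (F_log theta) beta = 0]
  | Polynomial => True
  end.

Definition beta_of (p : potential) : R :=
  match p with FloryHuggins _ beta => beta | Polynomial => 1 end.

(* [ln] is total ([ln x = 0] for [x <= 0]), so the logarithmic potential has
   its usual values on [-1, 1], with 0 ln 0 = 0, and its usual derivative on
   ]-1, 1[. *)
Definition F_of (p : potential) (chi : R) : R :=
  match p with
  | FloryHuggins theta beta => F_log theta chi - F_log theta beta
  | Polynomial => F_poly chi
  end.

Definition c_F (p : potential) : R :=
  \int[@lebesgue_measure R]_(chi in `[- beta_of p, beta_of p])
    Num.sqrt (2 * F_of p chi).

Definition wall_energy (eps theta_s : R) (p : potential) (chi : R) : R :=
  eps * c_F p * cos theta_s / (4 * beta_of p ^+ 3)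
  * (chi ^+ 3 - 3 * beta_of p ^+ 2 * chi).

End Potential.

(** ** The fully discrete upwind scheme *)

Section Scheme.
Variable R : realType.

Record params := Params {
  eps : R; kappa : R; dt : R; dx : R; dy : R; theta_s : R;
  Nx : nat; Ny : nat; N : nat;
  pot : potential R }.

(* Of the informal requirement that [eps] be small, only [eps < 1] is kept. *)
Record params_ok (P : params) : Prop := ParamsOk {
  eps_bounds : 0 < eps P < 1;
  kappa_gt0 : 0 < kappa P;
  dt_gt0 : 0 < dt P;
  dx_gt0 : 0 < dx P;
  dy_gt0 : 0 < dy P;
  theta_s_bounds : 0 <= theta_s P <= pi;
  Nx_gt0 : (0 < Nx P)%N;
  Ny_gt0 : (0 < Ny P)%N;
  N_gt0 : (0 < N P)%N;
  pot_ok : potential_ok (pot P) }.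

(* The first index is the time level.  The cells are 1 <= i <= Nx and
   1 <= j <= Ny; [phi] also carries the ghost values, at i = 0, i = Nx + 1,
   j = 0 and j = Ny + 1.  The face (i + 1/2, j) has index (i, j) in [Jx] and
   [Vx], and the face (i, j + 1/2) has index (i, j) in [Jy] and [Vy], so that
   the index 0 stands for 1/2.  All other entries are irrelevant. *)
Record scheme_data := SchemeData {
  phi : nat -> nat -> nat -> R;
  mu : nat -> nat -> nat -> R;
  Jx : nat -> nat -> nat -> R;
  Jy : nat -> nat -> nat -> R;
  Vx : nat -> nat -> nat -> R;
  Vy : nat -> nat -> nat -> R;
  xi : nat -> R;
  eta : nat -> R }.

Definition pos_part (x : R) : R := Num.max x 0.
(* Nonpositive, in contrast with the usual convention. *)
Definition neg_part (x : R) : R := Num.min x 0.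

Definition mobility (x y : R) : R := pos_part (1 + x) * pos_part (1 - y).

Definition upwind_flux (v x y : R) : R :=
  pos_part v * mobility x y + neg_part v * mobility y x.

Definition laplacian (P : params) (u : nat -> nat -> R) (i j : nat) : R :=
  (u i.+1 j - 2 * u i j + u i.-1 j) / dx P ^+ 2
  + (u i j.+1 - 2 * u i j + u i j.-1) / dy P ^+ 2.

Record scheme_step (P : params) (S : scheme_data) (n : nat) : Prop := Step {
  step_balance : forall i j, (1 <= i <= Nx P)%N -> (1 <= j <= Ny P)%N ->
    phi S n.+1 i j - phi S n i j =
    - (dt P / dx P * (Jx S n.+1 i j - Jx S n.+1 i.-1 j)
       + dt P / dy P * (Jy S n.+1 i j - Jy S n.+1 i j.-1));
  step_flux_x : forall i j, (1 <= i < Nx P)%N -> (1 <= j <= Ny P)%N ->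
    Jx S n.+1 i j =
    upwind_flux (Vx S n.+1 i j) (phi S n.+1 i j) (phi S n.+1 i.+1 j);
  step_velocity_x : forall i j, (1 <= i < Nx P)%N -> (1 <= j <= Ny P)%N ->
    Vx S n.+1 i j = - (1 / dx P) * (mu S n.+1 i.+1 j - mu S n.+1 i j);
  step_flux_y : forall i j, (1 <= i <= Nx P)%N -> (1 <= j < Ny P)%N ->
    Jy S n.+1 i j =
    upwind_flux (Vy S n.+1 i j) (phi S n.+1 i j) (phi S n.+1 i j.+1);
  step_velocity_y : forall i j, (1 <= i <= Nx P)%N -> (1 <= j < Ny P)%N ->
    Vy S n.+1 i j = - (1 / dy P) * (mu S n.+1 i j.+1 - mu S n.+1 i j);
  step_noflux_x : forall j, (1 <= j <= Ny P)%N ->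
    Jx S n.+1 0 j = 0 /\ Jx S n.+1 (Nx P) j = 0;
  step_noflux_y : forall i, (1 <= i <= Nx P)%N ->
    Jy S n.+1 i 0 = 0 /\ Jy S n.+1 i (Ny P) = 0;
  step_mu : forall i j, (1 <= i <= Nx P)%N -> (1 <= j <= Ny P)%N ->
    mu S n.+1 i j = - eps P ^+ 2 * laplacian P (phi S n.+1) i j
                    + xi S n.+1 * derive1 (F_of (pot P)) (phi S n.+1 i j);
  step_ghost_left : forall j, (1 <= j <= Ny P)%N ->
    phi S n.+1 0 j = phi S n.+1 1 j;
  step_ghost_right : forall j, (1 <= j <= Ny P)%N ->
    phi S n.+1 (Nx P).+1 j = phi S n.+1 (Nx P) j;
  step_ghost_top : forall i, (1 <= i <= Nx P)%N ->
    phi S n.+1 i (Ny P).+1 = phi S n.+1 i (Ny P);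
  step_ghost_wall : forall i, (1 <= i <= Nx P)%N ->
    phi S n.+1 i 0 =
    (1 - dy P / (eps P ^+ 2 * kappa P * dt P)) * phi S n.+1 i 1
    + dy P / (eps P ^+ 2 * kappa P * dt P) * phi S n i 1
    - dy P / eps P ^+ 2 * eta S n.+1
      * derive1 (wall_energy (eps P) (theta_s P) (pot P)) (phi S n.+1 i 1);
  step_xi :
    \sum_(1 <= i < (Nx P).+1) \sum_(1 <= j < (Ny P).+1)
      (F_of (pot P) (phi S n.+1 i j) - F_of (pot P) (phi S n i j)) =
    xi S n.+1 *
    \sum_(1 <= i < (Nx P).+1) \sum_(1 <= j < (Ny P).+1)
      derive1 (F_of (pot P)) (phi S n.+1 i j) * (phi S n.+1 i j - phi S n i j);
  step_eta :
    \sum_(1 <= i < (Nx P).+1)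
      (wall_energy (eps P) (theta_s P) (pot P) (phi S n.+1 i 1)
       - wall_energy (eps P) (theta_s P) (pot P) (phi S n i 1)) =
    eta S n.+1 *
    \sum_(1 <= i < (Nx P).+1)
      derive1 (wall_energy (eps P) (theta_s P) (pot P)) (phi S n.+1 i 1)
      * (phi S n.+1 i 1 - phi S n i 1) }.

Definition is_solution (P : params) (S : scheme_data) : Prop :=
  forall n, (n < N P)%N -> scheme_step P S n.

Definition mass (P : params) (S : scheme_data) (n : nat) : R :=
  \sum_(1 <= i < (Nx P).+1) \sum_(1 <= j < (Ny P).+1) phi S n i j.

End Scheme.

(* Main.v *)
Require Import Defs.
From mathcomp Require Import all_boot all_order all_algebra.
From mathcomp Require Import all_classical all_reals all_analysis.
Import GRing.Theory.
Local Open Scope ring_scope.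

(** The scheme is in conservative form: each cell average changes only by
    differences of fluxes through the faces of the cell.  Summed over the
    grid, every interior face is seen once as an outflow and once as an inflow,
    so only the boundary fluxes survive ([sum_flux_differences]); these vanish
    by the no-flux conditions.  Hence one step preserves the mass
    ([mass_step]), and all steps do by induction. *)

(** Discrete divergence theorem in one direction: each interior face is the
    right face of one cell and the left face of the next.  The index of a face
    is that of the cell on its left, whence the predecessor. *)
Lemma sum_flux_differences (V : zmodType) (J : nat -> V) (m : nat) :
  \sum_(1 <= i < m.+1) (J i - J i.-1) = J m - J 0%N.
Proof. by rewrite big_add1 /= telescope_sumr. Qed.

Lemma sum_flux_differences_eq0 {V : zmodType} {J : nat -> V} {m : nat} :
  J 0%N = 0 /\ J m = 0 -> \sum_(1 <= i < m.+1) (J i - J i.-1) = 0.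
Proof. by case=> J0 Jm; rewrite sum_flux_differences J0 Jm subrr. Qed.

Lemma mass_step (R : realType) (P : params R) (S : scheme_data R) (n : nat) :
  scheme_step P S n -> mass P S n.+1 = mass P S n.
Proof.
move=> step; apply/eqP; rewrite -subr_eq0 /mass -sumrB; apply/eqP.
under eq_big_nat => i Hi.
  rewrite -sumrB.
  under eq_big_nat => j Hj do rewrite (step_balance step Hi Hj).
  (* The column [i] has no net flux in the direction of [j]. *)
  rewrite sumrN big_split /= -!mulr_sumr.
  rewrite (sum_flux_differences_eq0 (step_noflux_y step Hi)) mulr0 addr0.
  over.
(* The remaining fluxes cancel along rows, so the sum over [i] must be made
   the inner one. *)
rewrite /= sumrN -mulr_sumr exchange_big_nat /= big_nat big1 ?mulr0 ?oppr0 //.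
by move=> j Hj; exact: (sum_flux_differences_eq0 (J := Jx S n.+1 ^~ j)
                          (step_noflux_x step Hj)).
Qed.

Theorem theorem2 (R : realType) (P : params R) (S : scheme_data R) :
  params_ok P -> is_solution P S ->
  forall n : nat, (n < N P)%N ->
  forall k : nat, (k <= n)%N -> mass P S n.+1 = mass P S k.
Proof.
move=> _ sol.
have mass0 m : (m <= N P)%N -> mass P S m = mass P S 0%N.
  elim: m => // m IH lt_mN.
  by rewrite (mass_step _ _ _ _ (sol m lt_mN)) IH // ltnW.
move=> n lt_nN k le_kn.
by rewrite !mass0 // (leq_trans le_kn) // ltnW.
Qed.
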